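(* Let $k>2$ and $\ell\geq 1$ be fixed integers. If $n > 2(k+\ell+2)\binom{6(k+\ell)}{\ell}$ and $G$ is an $n$-vertex $k$-chromatic graph with minimum degree at least $\ell$, then \[ i(G) \leq i(G^* )=\begin{cases} 2^{n-\ell}+k2^{\ell-k+1}-1, & k\leq \ell,\\ (k-\ell+1)2^{n-k}+\ell, & k>\ell, \end{cases} \] with equality $i(G)=i(G^* )$ if and only if $G=G^*$ (up to isomorphism). Here $G^*=(K_{k-1}\cup E_{\ell-k+1})\vee E_{n-\ell}$ if $k\leq \ell$, and $G^*=K_\ell\vee(K_{k-\ell}\cup E_{n-k})$ if $k>\ell$.
   Context: All graphs are finite and simple. An independent set of $G$ is a set of vertices no two of which are adjacent (the empty set is included); $i(G)$ denotes the number of independent sets of $G$. A graph is $k$-chromatic if its chromatic number is exactly $k$. $K_m$ and $E_m$ denote the complete and the empty (edgeless) graph on $m$ vertices, $\cup$ denotes disjoint union, and $G_1\vee G_2$ denotes the join: the graph with vertex set $V(G_1)\sqcup V(G_2)$ and edge set $E(G_1)\cup E(G_2)\cup\{xy: x\in V(G_1), y\in V(G_2)\}$. *)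

(* Defs.v *)
From mathcomp Require Import all_boot.

Set Implicit Arguments.
Unset Strict Implicit.
Unset Printing Implicit Defensive.

Record sgraph := SGraph {
  vertex :> finType;
  adj : rel vertex;
  adj_sym : symmetric adj;
  adj_irrefl : irreflexive adj
}.

Definition isomorphic (G H : sgraph) : Prop :=
  exists2 f : G -> H, bijective f & forall x y : G, adj (f x) (f y) = adj x y.

Definition independent (G : sgraph) (A : {set G}) : bool :=
  [forall x in A, forall y in A, ~~ adj x y].

Definition num_independent (G : sgraph) : nat :=
  #|[set A : {set G} | independent A]|.

Definition colorable (G : sgraph) (c : nat) : bool :=
  [exists f : {ffun G -> 'I_c},
    [forall x : G, forall y : G, adj x y ==> (f x != f y)]].

Lemma colorable_card (G : sgraph) : colorable G #|G|.
Proof.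
apply/existsP; exists [ffun x => enum_rank x].
apply/'forall_forallP => x y; apply/implyP => xy; rewrite !ffunE.
by apply: contraTneq xy => /enum_rank_inj ->; rewrite adj_irrefl.
Qed.

Definition chromatic_number (G : sgraph) : nat :=
  ex_minn (ex_intro (colorable G) _ (colorable_card G)).

Definition degree (G : sgraph) (x : G) : nat := #|[set y : G | adj x y]|.

(* The default #|G| exceeds every degree, so it matters only when G has no
   vertex. *)
Definition min_degree (G : sgraph) : nat :=
  \big[minn/#|G|]_(x : G) degree x.

Section Constructions.

Variables (m : nat) (G H : sgraph).

Definition complete_adj : rel 'I_m := fun x y => x != y.

Lemma complete_sym : symmetric complete_adj.
Proof. by move=> x y; rewrite /complete_adj eq_sym. Qed.

Lemma complete_irrefl : irreflexive complete_adj.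
Proof. by move=> x; rewrite /complete_adj eqxx. Qed.

Definition complete : sgraph := SGraph complete_sym complete_irrefl.

Definition edgeless_adj : rel 'I_m := fun _ _ => false.

Lemma edgeless_sym : symmetric edgeless_adj.
Proof. by []. Qed.

Lemma edgeless_irrefl : irreflexive edgeless_adj.
Proof. by []. Qed.

Definition edgeless : sgraph := SGraph edgeless_sym edgeless_irrefl.

(* [cross] tells whether vertices from different sides are adjacent. *)
Definition sum_adj (cross : bool) : rel (G + H)%type := fun u v =>
  match u, v with
  | inl x, inl y => adj x y
  | inr x, inr y => adj x y
  | _, _ => cross
  end.

Lemma sum_sym cross : symmetric (sum_adj cross).
Proof. by move=> [x|x] [y|y] //=; rewrite adj_sym. Qed.

Lemma sum_irrefl cross : irreflexive (sum_adj cross).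
Proof. by move=> [x|x] /=; rewrite adj_irrefl. Qed.

Definition disjoint_union : sgraph :=
  SGraph (sum_sym false) (sum_irrefl false).

Definition join : sgraph := SGraph (sum_sym true) (sum_irrefl true).

End Constructions.

Definition Gstar (k l n : nat) : sgraph :=
  if k <= l then
    join (disjoint_union (complete (k - 1)) (edgeless (l - k + 1)))
         (edgeless (n - l))
  else
    join (complete l)
         (disjoint_union (complete (k - l)) (edgeless (n - k))).

(* Main.v *)
Require Import Defs.
From mathcomp Require Import all_boot zify.

Set Implicit Arguments.
Unset Strict Implicit.
Unset Printing Implicit Defensive.

(** Put [q = k + l]. The extremal graph has at least [2 ^ (n - q)] independent
    sets, so a graph with so many disjoint edges that they force the count
    below this value is not a competitor; [3 * q] disjoint edges suffice, since
    each of them multiplies the count by at most [3/4] and [(3/4)^3 < 1/2]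
    ([matching_or_cover], [many_edges_bound]).

    Otherwise a vertex cover [T] of size at most [6 * q] exists. Every vertex
    outside [T] has its neighbours, at least [l] of them, inside [T]; as [n] is
    large, the pigeonhole principle gives an [l]-set [L] with at least
    [2 * q + 4] common neighbours ([exists_common_neighbours]). An independent
    set that meets [L] avoids these common neighbours, so there are at most
    [2 ^ (n - 2 * q - 4)] such sets. This is negligible, and the count is
    governed by the independent sets of [G - L].

    The remaining tool is a bound with stability: a graph on [m] vertices of
    chromatic number at least [c > 0] has at most [(c + 1) * 2 ^ (m - c)]
    independent sets, and unless it is a [c]-clique plus isolated vertices it
    misses the bound by at least [2 ^ (m - c - 2)] ([indep_count_stability]).

    If [k <= l], an edge in [G - L] costs a quarter of [2 ^ (n - l)], more than
    the negligible term. So [G - L] is edgeless, the degree condition joins it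
    completely to [L], and [L] has chromatic number at least [k - 1]; the bound
    for [L] identifies the graph. If [k > l], then [G - L] has chromatic number
    at least [k - l], and the gap in the stability statement exceeds the
    negligible term. So [G - L] is a [(k - l)]-clique plus isolated vertices;
    the isolated vertices are joined to all of [L] by the degree condition, and
    a missing edge between two vertices of the clique and [L] would permit a
    colouring with [k - 1] colours. *)

Section SetsOfVertices.

Variable G : sgraph.
Implicit Types (x y : G) (A B S T L : {set G}).

(** * Independent sets inside a set of vertices *)

Definition neighbours x : {set G} := [set y | adj x y].

Definition indep_count A : nat :=
  #|[set B : {set G} | (B \subset A) && independent B]|.

Lemma independentP A :
  reflect {in A &, forall x y, ~~ adj x y} (independent A).
Proof.
apply: (iffP forall_inP) => [h x y xA yA | h x xA].
  exact: (forall_inP (h x xA)).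
by apply/forall_inP => y; apply: h.
Qed.

Lemma independent_sub A B : A \subset B -> independent B -> independent A.
Proof.
move=> /subsetP sAB /independentP iB; apply/independentP => x y xA yA.
by apply: iB; apply: sAB.
Qed.

Lemma not_independentP A :
  reflect (exists x y, [/\ x \in A, y \in A & adj x y]) (~~ independent A).
Proof.
apply: (iffP idP) => [|[x [y [xA yA xy]]]].
  case/forall_inPn => x xA /forall_inPn[y yA]; rewrite negbK => xy.
  by exists x, y.
by apply/negP => /independentP/(_ x y xA yA); rewrite xy.
Qed.

Lemma num_independentE : num_independent G = indep_count setT.
Proof. by apply: eq_card => B; rewrite !inE subsetT. Qed.

Lemma indep_count_leq_exp A : indep_count A <= 2 ^ #|A|.
Proof.
rewrite -card_powerset; apply: subset_leq_card; apply/subsetP => B.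
by rewrite !inE => /andP[].
Qed.

Lemma indep_count_sub A B : A \subset B -> indep_count A <= indep_count B.
Proof.
move=> sAB; apply: subset_leq_card; apply/subsetP => C; rewrite !inE.
by case/andP => /subset_trans -> //.
Qed.

(** An independent set containing [x] is determined by its other vertices,
    none of which is a neighbour of [x]; the first summand counts the sets
    without [x]. *)
Lemma indep_count_delete A x : x \in A ->
  indep_count A <=
    indep_count (A :\ x) + indep_count (A :\: (x |: neighbours x)).
Proof.
move=> xA; rewrite /indep_count.
set I := [set B : {set G} | (B \subset A) && independent B].
rewrite -(cardsID [set B : {set G} | x \notin B] I); apply: leq_add.
  apply: subset_leq_card; apply/subsetP => B.
  rewrite !inE -andbA => /and3P[sBA iB xB].
  by rewrite iB andbT subsetD1 sBA.
have inj : {in I :\: [set B : {set G} | x \notin B] &, injective (fun B : {set G} => B :\ x)}.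
  move=> B C; rewrite !inE !negbK => /andP[xB _] /andP[xC _] e.
  by rewrite -(setD1K xB) -(setD1K xC) e.
rewrite -(card_in_imset inj); apply: subset_leq_card; apply/subsetP => C /imsetP[B + ->].
rewrite !inE negbK => /and3P[xB sBA iB].
rewrite (independent_sub (subD1set _ _) iB) andbT.
apply/subsetP => y; rewrite !inE negb_or => /andP[-> yB] /=.
by rewrite (subsetP sBA) // andbT; move/independentP: iB; apply.
Qed.

Lemma card_delete_neighbours A x : x \in A ->
  #|A :\: (x |: neighbours x)| + #|neighbours x :&: A| + 1 = #|A|.
Proof.
move=> xA; rewrite -(cardsID (x |: neighbours x) A) (_ : A :&: _ = x |: (neighbours x :&: A)).
  by rewrite cardsU1 !inE adj_irrefl /=; lia.
by apply/setP => y; rewrite !inE; case: eqP => [->|_] /=; rewrite ?xA // andbC.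
Qed.

Lemma indep_count_edge A x y : x \in A -> y \in A -> adj x y ->
  indep_count A <= 3 * indep_count (A :\ x :\ y).
Proof.
move=> xA yA xy.
have yAx : y \in A :\ x by rewrite !inE yA andbT; apply: contraTneq xy => ->; rewrite adj_irrefl.
have h1 := indep_count_delete xA; have h2 := indep_count_delete yAx.
have h3 : indep_count (A :\: (x |: neighbours x)) <= indep_count (A :\ x :\ y).
  apply: indep_count_sub; apply/subsetP => z; rewrite !inE negb_or -!andbA.
  case/and3P => -> nxz ->; rewrite !andbT.
  by apply: contraNneq nxz => ->.
have h4 : indep_count (A :\ x :\: (y |: neighbours y)) <= indep_count (A :\ x :\ y).
  by apply: indep_count_sub; apply: setDS; rewrite sub1set setU11.
lia.
Qed.

Lemma exp_card_delete A x : x \in A -> 2 ^ #|A| = 2 * 2 ^ #|A :\ x|.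
Proof. by move=> xA; rewrite (cardsD1 x A) xA add1n expnS. Qed.

Lemma card_delete_edge A x y : x \in A -> y \in A -> adj x y ->
  #|A :\ x :\ y| + 2 = #|A|.
Proof.
move=> xA yA xy; rewrite (cardsD1 x A) xA (cardsD1 y (A :\ x)) !inE yA andbT.
have -> : y != x by apply: contraTneq xy => ->; rewrite adj_irrefl.
by rewrite /= addnC addnA.
Qed.

Lemma indep_count_not_independent A : ~~ independent A ->
  indep_count A * 4 <= 3 * 2 ^ #|A|.
Proof.
case/not_independentP => x [y [xA yA xy]].
rewrite -(card_delete_edge xA yA xy) expnD.
have := indep_count_edge xA yA xy; have := indep_count_leq_exp (A :\ x :\ y).
lia.
Qed.

(** Each edge of a matching leaves three choices on its two ends, and the
    unmatched vertices of a maximal matching are independent: either [m]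
    disjoint edges cut the count by [(3/4)^m], or fewer than [m] edges form a
    vertex cover. *)
Lemma matching_or_cover m A :
  indep_count A * 4 ^ m <= 3 ^ m * 2 ^ #|A| \/
  exists T, #|T| <= 2 * m /\ independent (A :\: T).
Proof.
elim: m A => [|m IH] A; first by left; have := indep_count_leq_exp A; lia.
have [iA | /not_independentP[x [y [xA yA xy]]]] := boolP (independent A).
  by right; exists set0; rewrite cards0 setD0.
case: (IH (A :\ x :\ y)) => [h | [T [cT iT]]]; [left | right].
  rewrite -(card_delete_edge xA yA xy) expnD !(expnS _ m).
  have := indep_count_edge xA yA xy; move: h.
  set a := indep_count _; set b := indep_count A; set u := 4 ^ m; set v := 3 ^ m.
  set w := 2 ^ _ => h h1.
  have := leq_mul h1 (leqnn u); nia.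
exists (x |: (y |: T)); split.
  have := leq_card_setU [set x] (y |: T); have := leq_card_setU [set y] T.
  rewrite !cards1 => -[h1 _] [h2 _]; lia.
rewrite (_ : A :\: _ = A :\ x :\ y :\: T) //.
by apply/setP => z; rewrite !inE !negb_or; case: (z == x); case: (z == y); case: (z \in T).
Qed.

(** * Colourings of a set of vertices *)

Definition set_colorable A d : bool :=
  [exists f : {ffun G -> 'I_d.+1}, [forall x in A,
    (f x < d) && [forall y in A, adj x y ==> (f x != f y)]]].

Lemma set_colorableP A d :
  reflect (exists f : G -> nat, {in A, forall x, f x < d} /\
             {in A &, forall x y, adj x y -> f x != f y})
          (set_colorable A d).
Proof.
apply: (iffP existsP) => [[f /forall_inP h] | [f [fd fadj]]].
  exists (fun x => val (f x)); split=> [x xA | x y xA yA xy].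
    by case/andP: (h x xA).
  by case/andP: (h x xA) => _ /forall_inP/(_ y yA); rewrite xy.
exists [ffun x => inord (f x)]; apply/forall_inP => x xA; rewrite !ffunE.
have e z : z \in A -> val (inord (f z) : 'I_d.+1) = f z.
  by move=> zA; apply: inordK; apply: ltnW; rewrite ltnS fd.
rewrite -[nat_of_ord _]/(val _) e // fd //=; apply/forall_inP => y yA; apply/implyP => xy.
by rewrite ffunE -val_eqE !e //; apply: fadj.
Qed.

(** A lower bound on the chromatic number of [A], in a form that is vacuous for
    [c = 0], where the induction proving [indep_count_chi_geq] starts. *)
Definition chi_geq A c := forall d, set_colorable A d -> c <= d.

Lemma chi_geqP A c : chi_geq A c.+1 <-> ~~ set_colorable A c.
Proof.
split=> [h | h d hd]; first by apply/negP => /h; rewrite ltnn.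
rewrite ltnNge; apply: contra h => dc.
have [f [fd fadj]] := set_colorableP _ _ hd.
apply/set_colorableP; exists f; split=> // x xA.
exact: leq_trans (fd x xA) dc.
Qed.

Lemma set_colorable_card A : set_colorable A #|A|.
Proof.
apply/set_colorableP; exists (fun x => index x (enum A)); split=> [x xA|x y xA yA xy].
  by rewrite cardE index_mem mem_enum.
apply: contraTneq xy => e.
suff -> : x = y by rewrite adj_irrefl.
by rewrite -(nth_index x (s := enum A) (x := x)) ?mem_enum // e nth_index ?mem_enum.
Qed.

Lemma set_colorable_independent A : independent A -> set_colorable A 1.
Proof.
move=> /independentP iA; apply/set_colorableP; exists (fun=> 0); split=> // x y xA yA xy.
by have := iA x y xA yA; rewrite xy.
Qed.

Lemma set_colorable_setU A B a b :
  set_colorable A a -> set_colorable B b -> set_colorable (A :|: B) (a + b).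
Proof.
move=> /set_colorableP[f [fa fadj]] /set_colorableP[g [gb gadj]].
apply/set_colorableP; exists (fun x => if x \in A then f x else a + g x); split=> [x|x y].
  rewrite inE; case: ifP => /= [xA _ | _ xB]; first by rewrite ltn_addr ?fa.
  by rewrite ltn_add2l gb.
rewrite !inE; case: ifP => /= xA; case: ifP => /= yA xB yB xy.
- exact: fadj.
- by rewrite neq_ltn ltn_addr // fa.
- by rewrite eq_sym neq_ltn ltn_addr // fa.
- by rewrite eqn_add2l gadj.
Qed.

Lemma set_colorable_sub A B d : A \subset B -> set_colorable B d -> set_colorable A d.
Proof.
move=> /subsetP sAB /set_colorableP[f [fd fadj]].
apply/set_colorableP; exists f; split=> [x /sAB|x y /sAB xB /sAB]; [exact: fd|exact: fadj].
Qed.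

Lemma chi_geq_setD A B b c : set_colorable B b -> chi_geq A c -> chi_geq (A :\: B) (c - b).
Proof.
move=> hB hA d hd.
have : set_colorable A (d + b).
  apply: set_colorable_sub (set_colorable_setU hd hB).
  by apply/subsetP => x xA; rewrite !inE xA; case: (x \in B).
by move/hA; rewrite leq_subLR addnC.
Qed.

Lemma chi_geq_setD1 A x c : chi_geq A c.+1 -> chi_geq (A :\ x) c.
Proof.
move/(@chi_geq_setD A [set x] 1 c.+1); rewrite subSS subn0; apply.
by rewrite -(cards1 x); apply: set_colorable_card.
Qed.

Lemma set_colorable_setT d : set_colorable setT d -> colorable G d.
Proof.
move=> /set_colorableP[f [fd fadj]].
apply/existsP; exists [ffun x => Ordinal (fd x (in_setT x))].
apply/forallP => x; apply/forallP => y; apply/implyP => xy; rewrite !ffunE -val_eqE /=.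
by apply: fadj.
Qed.

Lemma chi_geq_setT : chi_geq setT (chromatic_number G).
Proof.
move=> d /set_colorable_setT cd; rewrite /chromatic_number.
by case: ex_minnP => m _; apply.
Qed.

(** The colour [c] of [x] is passed explicitly: the two uses are copying the
    colour of a twin and picking a colour free in the neighbourhood. *)
Lemma set_colorable_extend A x (f : G -> nat) d c :
    c < d -> {in A :\ x, forall y, f y < d} ->
    {in A :\ x &, forall y z, adj y z -> f y != f z} ->
    {in A :\ x, forall z, adj x z -> f z != c} ->
  set_colorable A d.
Proof.
move=> cd fd fadj fx.
apply/set_colorableP; exists (fun y => if y == x then c else f y); split=> [y yA|y z yA zA].
  by case: eqP => // /eqP yx; apply: fd; rewrite !inE yx.
have [->|yx] := eqVneq y x; have [->|zx] := eqVneq z x; move=> yz.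
- by rewrite adj_irrefl in yz.
- by rewrite eq_sym fx // !inE zx.
- by rewrite fx // ?[adj x y]adj_sym // !inE yx.
- by apply: fadj; rewrite // !inE ?yx ?zx.
Qed.

Lemma set_colorable_twin A x y d : x \in A -> y \in A -> x != y ->
  neighbours x :&: A \subset neighbours y ->
  set_colorable (A :\ x) d -> set_colorable A d.
Proof.
move=> xA yA xy sN /set_colorableP[f [fd fadj]].
have yAx : y \in A :\ x by rewrite !inE eq_sym xy.
apply: (@set_colorable_extend A x f d (f y)) => //; first exact: fd.
move=> z zA xz; rewrite eq_sym fadj //.
have : z \in neighbours x :&: A by move: zA; rewrite !inE xz => /andP[_ ->].
by move/(subsetP sN); rewrite inE.
Qed.

(** The neighbours of [x] block fewer than [d] colours. *)
Lemma set_colorable_low_degree A x d : #|neighbours x :&: A| < d ->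
  set_colorable (A :\ x) d -> set_colorable A d.
Proof.
move=> hdeg /set_colorableP[f [fd fadj]].
have d0 : 0 < d by apply: leq_ltn_trans hdeg.
(* The successor in the index type is what [inord] asks for. *)
pose u : {set 'I_d.-1.+1} := [set inord (f z) | z in neighbours x :&: A].
have : #|u| < #|[set: 'I_d.-1.+1]|.
  have -> : #|[set: 'I_d.-1.+1]| = d by rewrite cardsT card_ord prednK.
  exact: leq_ltn_trans (leq_imset_card _ _) hdeg.
have [c cu _ | all] := pickP [pred c | c \notin u]; last first.
  rewrite ltnNge => /negP[]; apply: subset_leq_card; apply/subsetP => c _.
  by have /negbFE := all c.
apply: (@set_colorable_extend A x f d c) => //; first by rewrite -[X in _ < X](prednK d0).
move=> z zA xz; apply: contraNneq cu => e; apply/imsetP; exists z.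
  by move: zA; rewrite !inE xz => /andP[].
by apply: val_inj; rewrite /= inordK // prednK // fd.
Qed.

(** Two nonadjacent vertices can share a colour. *)
Lemma set_colorable_nonadjacent A x y : x \in A -> y \in A -> x != y ->
  ~~ adj x y -> set_colorable A #|A|.-1.
Proof.
move=> xA yA xy nxy.
rewrite -(setD1K xA) -(setD1K (_ : y \in A :\ x)) ?inE ?(eq_sym y) ?xy //.
rewrite setUA cardsU !cards2 xy.
set B := A :\ x :\ y.
have -> : [set x; y] :&: B = set0.
  by apply/setP => z; rewrite !inE; do 2 case: eqP => //=; rewrite ?andbF.
rewrite cards0 subn0 addSn -pred_Sn; apply: set_colorable_setU (set_colorable_card _).
apply: set_colorable_independent; apply/independentP => a b.
rewrite !inE => /orP[] /eqP-> /orP[] /eqP->; rewrite ?adj_irrefl //.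
by rewrite adj_sym.
Qed.

(** * Many colours force few independent sets *)

Lemma critical_subset A c : chi_geq A c.+1 ->
  exists S : {set G}, [/\ S \subset A, S != set0, ~~ set_colorable S c
              & forall x, x \in S -> set_colorable (S :\ x) c].
Proof.
move/chi_geqP => hA.
have [S /minsetP[hS minS] sSA] := minset_exists (P := fun S => ~~ set_colorable S c) hA.
exists S; split=> // [|x xS].
  apply: contraNneq hS => ->; apply/set_colorableP; exists (fun=> 0).
  by split=> [x|x y]; rewrite inE.
apply: contraTT xS => h.
by rewrite -(minS _ h (subD1set _ _)) !inE eqxx.
Qed.

Lemma critical_degree S c x : ~~ set_colorable S c -> set_colorable (S :\ x) c ->
  c <= #|neighbours x :&: S|.
Proof.
move=> hS hx; rewrite leqNgt; apply: contra hS => h.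
exact: set_colorable_low_degree h hx.
Qed.

Lemma indep_count_delete_neighbours A x r : x \in A -> r <= #|neighbours x :&: A| ->
  indep_count (A :\: (x |: neighbours x)) * 2 ^ r.+1 <= 2 ^ #|A|.
Proof.
move=> xA hr; apply: leq_trans (leq_mul (indep_count_leq_exp _) (leqnn _)) _.
by rewrite -expnD leq_exp2l // -(card_delete_neighbours xA); lia.
Qed.

(** Delete a vertex [x] of a critical subset. The rest still needs one colour
    less, and [x] has at least [c - 1] neighbours, so the sets containing [x]
    contribute at most [2 ^ (#|A| - c)]. *)
Lemma indep_count_chi_geq c A :
  chi_geq A c -> indep_count A * 2 ^ c <= c.+1 * 2 ^ #|A|.
Proof.
elim: c A => [|c IH] A hA; first by have := indep_count_leq_exp A; lia.
have [S [sSA /set0Pn[x xS] hS hx]] := critical_subset hA.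
have xA := subsetP sSA x xS.
have deg : c <= #|neighbours x :&: A|.
  exact: leq_trans (critical_degree hS (hx x xS)) (subset_leq_card (setIS _ sSA)).
have := IH _ (chi_geq_setD1 (x := x) hA); have := indep_count_delete_neighbours xA deg.
have := indep_count_delete xA.
rewrite (exp_card_delete xA).
rewrite expnS; set a := indep_count A; set b := indep_count _; set d := indep_count _.
set u := 2 ^ c; set w := 2 ^ _ => h1 h2 h3.
have := leq_mul h1 (leqnn u); nia.
Qed.

(** In the preceding argument a loss occurs as soon as some degree exceeds [c],
    or the non-neighbours of the deleted vertex [x] span an edge. If neither
    happens, a critical subset [S] is a union of components in which all
    degrees are [c]. A vertex of [S] not adjacent to [x] would then have the
    same neighbours as [x], which is impossible in a critical graph; so [S] is
    a clique on [c + 1] vertices, and the remaining vertices are isolated. *)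
Lemma indep_count_stability c A : chi_geq A c.+1 ->
  indep_count A * 2 ^ c.+3 + 2 ^ #|A| <= 4 * c.+2 * 2 ^ #|A| \/
  exists K : {set G}, [/\ K \subset A, #|K| = c.+1, {in K &, forall x y, x != y -> adj x y}
              & {in A :\: K & A, forall x y, ~~ adj x y}].
Proof.
move=> hA.
(* The trivial bound on the sets containing [x] has the constant 4 instead
   of 3; the difference is the gap [2 ^ #|A|]. *)
have bound x : x \in A ->
    indep_count (A :\: (x |: neighbours x)) * 2 ^ c.+3 <= 3 * 2 ^ #|A| ->
    indep_count A * 2 ^ c.+3 + 2 ^ #|A| <= 4 * c.+2 * 2 ^ #|A|.
  move=> xA.
  have := indep_count_chi_geq (chi_geq_setD1 (x := x) hA).
  have := indep_count_delete xA.
  rewrite (exp_card_delete xA).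
  rewrite !expnS; set a := indep_count A; set b := indep_count _; set d := indep_count _.
  set u := 2 ^ c; set w := 2 ^ _ => h1 h2 h3.
  have := leq_mul h1 (leqnn u); nia.
have [/exists_inP[x xA deg] | small] :=
    boolP [exists x in A, c.+1 <= #|neighbours x :&: A|].
  left; apply: (bound x) => //.
  by have := indep_count_delete_neighbours xA deg; rewrite !(expnS _ c.+2); lia.
have {}small x : x \in A -> #|neighbours x :&: A| <= c.
  move=> xA; rewrite leqNgt; apply: contra small => h.
  by apply/existsP; exists x; rewrite xA.
have [S [sSA /set0Pn[x xS] hS hx]] := critical_subset hA.
have sA := subsetP sSA.
have nbS y : y \in S -> neighbours y :&: A = neighbours y :&: S.
  move=> yS; apply/esym/eqP; rewrite eqEcard setIS //=.
  exact: leq_trans (small y (sA y yS)) (critical_degree hS (hx y yS)).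
have degS y : y \in S -> #|neighbours y :&: S| = c.
  move=> yS; apply/eqP; rewrite eqn_leq -{1}nbS // small ?sA //.
  exact: critical_degree hS (hx y yS).
have [iR | nR] := boolP (independent (A :\: (x |: neighbours x))); last first.
  left; apply: (bound x) (sA x xS) _.
  have := card_delete_neighbours (sA x xS); rewrite nbS // degS // addn1 => <-.
  have := indep_count_not_independent nR.
  rewrite -addnS expnD !expnS; set a := indep_count _; set w := 2 ^ _ => h.
  have := leq_mul h (leqnn (2 ^ c)); nia.
right; exists S.
(* A vertex [y] outside would be a twin of [x]. *)
have sSN : S \subset x |: neighbours x.
  apply/subsetP => y yS; apply: contraNT hS => yN.
  have xy : x != y by apply: contraNneq yN => ->; rewrite !inE eqxx.
  apply: (set_colorable_twin xS yS xy) (hx x xS).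
  suff <- : neighbours y :&: S = neighbours x :&: S by apply: subsetIl.
  apply/eqP; rewrite eqEcard !degS // leqnn andbT; apply/subsetP => z.
  rewrite [in X in X -> _]inE => /andP[yz zS]; rewrite inE zS andbT.
  apply: contraTT yz => zN; rewrite inE.
  have [->|zx] := eqVneq z x.
    by move: yN; rewrite !inE negb_or adj_sym => /andP[].
  move/independentP: iR; apply; rewrite inE sA // andbT //.
  by rewrite !inE negb_or zx; move: zN; rewrite inE.
have cS : #|S| = c.+1.
  rewrite (cardsD1 x) xS -(degS x xS); congr _.+1.
  apply: eq_card => z; rewrite !inE.
  case zS: (z \in S); rewrite ?andbF ?andbT //.
  have := subsetP sSN z zS; rewrite !inE; case: eqP => [->|] //=.
  by rewrite adj_irrefl.
split=> // [y z yS zS yz | y z].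
  apply: contraNT hS => nyz; have -> : c = #|S|.-1 by rewrite cS.
  exact: set_colorable_nonadjacent yS zS yz nyz.
rewrite inE => /andP[yS yA] zA; apply/negP => yz.
have [zS|zS] := boolP (z \in S).
  have : y \in neighbours z :&: A by rewrite !inE adj_sym yz.
  by rewrite nbS // inE (negPf yS) andbF.
have inR w : w \in A -> w \notin S -> w \in A :\: (x |: neighbours x).
  move=> wA wS; rewrite inE wA andbT !inE negb_or; apply/andP; split.
    by apply: contraNneq wS => ->.
  apply/negP => xw; have : w \in neighbours x :&: A by rewrite !inE xw.
  by rewrite nbS // inE (negPf wS) andbF.
by move/independentP: iR => /(_ y z (inR y yA yS) (inR z zA zS)); rewrite yz.
Qed.

(** * A small set with many common neighbours *)

Definition common_neighbours L : {set G} := [set v | L \subset neighbours v].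

(** Every vertex [v] outside the vertex cover [T] is a common neighbour of some
    [l]-subset of [T], and there are only ['C(#|T|, l)] such subsets. *)
Lemma exists_common_neighbours T l b : independent (~: T) ->
    (forall v : G, l <= degree v) -> b * 'C(#|T|, l) < #|~: T| ->
  exists L, #|L| = l /\ b < #|common_neighbours L|.
Proof.
move=> iT hdeg hb.
pose D := [set L : {set G} | L \subset T & #|L| == l].
have [/exists_inP[L] | /exists_inPn h] := boolP [exists L in D, b < #|common_neighbours L|].
  by rewrite inE => /andP[_ /eqP cL] bL; exists L.
case/negP: (negbT (ltnn #|~: T|)); apply: leq_trans hb; rewrite ltnS.
rewrite -(cards_draws T l) -/D mulnC -sum_nat_const.
apply: (@leq_trans (\sum_(L in D) #|common_neighbours L|)); last first.
  by apply: leq_sum => L LD; rewrite leqNgt h.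
have -> : \sum_(L in D) #|common_neighbours L|
    = \sum_(v : G) \sum_(L in D) (L \subset neighbours v).
  rewrite exchange_big; apply: eq_bigr => L _ /=.
  by rewrite -sum1dep_card [in LHS]big_mkcond.
rewrite (bigID (mem (~: T))) /= -sum1_card; apply: leq_trans (leq_addr _ _).
apply: leq_sum => v vT.
have : 0 < #|[set L : {set G} | L \subset neighbours v & #|L| == l]|.
  by rewrite cards_draws bin_gt0; apply: hdeg.
case/card_gt0P => L; rewrite inE => /andP[sL cL].
rewrite (bigD1 L) /= ?sL // inE cL andbT; apply: subset_trans sL _.
apply/subsetP => w; rewrite inE => vw; apply: contraTT vw => wT.
by move/independentP: iT; apply => //; rewrite inE.
Qed.

(** An independent set that meets [L] avoids every common neighbour of [L]; the
    second summand bounds the number of these sets. *)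
Lemma num_independent_split L :
  num_independent G <= indep_count (~: L) + 2 ^ #|~: common_neighbours L|.
Proof.
rewrite -card_powerset; set P := powerset _.
apply: leq_trans (leq_card_setU _ P); apply: subset_leq_card; apply/subsetP => B.
rewrite !inE => iB; have [_|/subsetPn[x xB]] := boolP (B \subset ~: L).
  by rewrite iB.
rewrite inE negbK => xL; apply/orP; right; apply/subsetP => y yB; rewrite !inE.
apply/negP => /subsetP/(_ x xL); rewrite inE => yx.
by move/independentP: iB => /(_ y x yB xB); rewrite yx.
Qed.

(** Every independent set lies on one side; the empty set, which lies on both,
    accounts for the added 1. *)
Lemma num_independent_bipartition L : independent (~: L) ->
    {in L & ~: L, forall x y, adj x y} ->
  num_independent G + 1 <= 2 ^ #|~: L| + indep_count L.
Proof.
move=> iL adjL.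
pose I := [set B : {set G} | (B \subset L) && independent B].
rewrite -card_powerset -[indep_count L]/#|I| -cardsUI; apply: leq_add.
  apply: subset_leq_card; apply/subsetP => B; rewrite !inE => iB; rewrite iB andbT.
  have [//|/subsetPn[x xB]] := boolP (B \subset ~: L).
  rewrite inE negbK => xL; apply/subsetP => y yB; apply/negPn/negP => yL.
  by move/independentP: iB => /(_ x y xB yB); rewrite adjL // inE.
rewrite card_gt0; apply/set0Pn; exists set0; rewrite !inE !sub0set /=.
by apply/independentP => x y; rewrite inE.
Qed.

Lemma all_adjacent L v : #|L| <= degree v -> neighbours v \subset L ->
  {in L, forall x, adj v x}.
Proof.
move=> hd sN x xL.
have /eqP e : neighbours v == L by rewrite eqEcard sN.
by move: xL; rewrite -e inE.
Qed.

End SetsOfVertices.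

(** * Isomorphisms *)

Lemma isomorphic_sym (G H : sgraph) : isomorphic G H -> isomorphic H G.
Proof.
case=> f [g fK gK] fadj; exists g; first by exists f.
by move=> x y; rewrite -fadj !gK.
Qed.

Lemma num_independent_isomorphic (G H : sgraph) :
  isomorphic G H -> num_independent G = num_independent H.
Proof.
suff le G' H' : isomorphic G' H' -> num_independent G' <= num_independent H'.
  by move=> GH; apply/eqP; rewrite eqn_leq !le //; apply: isomorphic_sym.
case=> f /bij_inj finj fadj.
rewrite /num_independent -(card_imset _ (imset_inj finj)); apply: subset_leq_card.
apply/subsetP => B /imsetP[A + ->]; rewrite !inE => /forall_inP iA.
apply/forall_inP => _ /imsetP[x xA ->]; apply/forall_inP => _ /imsetP[y yA ->].
by rewrite fadj; apply: (forall_inP (iA x xA)).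
Qed.

(** Match the elements of corresponding fibres in the order in which they are
    enumerated. *)
Lemma fibre_injection (A B : finType) (T : eqType) (tA : A -> T) (tB : B -> T) :
    (forall i, #|[set x | tA x == i]| = #|[set y | tB y == i]|) ->
  exists f : A -> B, injective f /\ forall x, tB (f x) = tA x.
Proof.
move=> h.
pose sA i := enum [set x | tA x == i]; pose sB i := enum [set y | tB y == i].
have hs i : size (sA i) = size (sB i) by rewrite -!cardE h.
have inA x : x \in sA (tA x) by rewrite mem_enum inE.
have pick (x : A) : B.
  have : 0 < #|[set y | tB y == tA x]|.
    by rewrite -h card_gt0; apply/set0Pn; exists x; rewrite inE.
  by rewrite card_gt0 => /set0Pn/sigW[y _]; exact: y.
pose f x := nth (pick x) (sB (tA x)) (index x (sA (tA x))).
have inB x : f x \in sB (tA x) by rewrite mem_nth // -hs index_mem.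
have ft x : tB (f x) = tA x by have := inB x; rewrite mem_enum inE => /eqP.
exists f; split=> // x y e.
have et : tA x = tA y by rewrite -!ft e.
have ei : index x (sA (tA x)) = index y (sA (tA x)).
  have ix := inA x; have iy := inA y; rewrite -et in iy.
  apply/eqP; rewrite -(nth_uniq (pick x) _ _ (enum_uniq [set z | tB z == tA x])) -/(sB _).
  - by rewrite -/(f x) e /f -et (set_nth_default (pick y)) // -hs index_mem.
  - by rewrite -hs index_mem.
  - by rewrite -hs index_mem.
have iy := inA y; rewrite -et in iy.
by rewrite -(nth_index x (inA x)) ei nth_index.
Qed.

(** Graphs whose adjacency depends only on the types of two distinct vertices
    are determined, up to isomorphism, by the number of vertices of each type. *)
Lemma typed_isomorphic (G H : sgraph) (T : eqType) (r : rel T) (tG : G -> T) (tH : H -> T) :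
    (forall x y : G, adj x y = (x != y) && r (tG x) (tG y)) ->
    (forall x y : H, adj x y = (x != y) && r (tH x) (tH y)) ->
    (forall i, #|[set x | tG x == i]| = #|[set y | tH y == i]|) ->
  isomorphic G H.
Proof.
move=> hG hH h.
have [f [finj ft]] := fibre_injection h.
have [g [ginj _]] := fibre_injection (fun i => esym (h i)).
exists f; first exact: inj_card_bij finj (leq_card g ginj).
by move=> x y; rewrite hG hH (inj_eq finj) !ft.
Qed.

(** * Independent sets of joins and disjoint unions *)

Lemma num_independent_complete m : num_independent (complete m) = m.+1.
Proof.
rewrite /num_independent.
have -> : [set A : {set complete m} | independent A]
    = set0 |: [set [set x] | x in [set: complete m]].
  apply/setP => A; rewrite !inE.
  have [-> | /set0Pn[x xA]] /= := eqVneq A set0.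
    by apply/forall_inP => x; rewrite inE.
  apply/forall_inP/imsetP => [iA | [y _ ->]].
    exists x => //; apply/setP => y; rewrite inE; apply/idP/eqP => [yA|-> //].
    by have /forall_inP/(_ y yA) := iA x xA; rewrite negbK => /eqP.
  move=> z /set1P->; apply/forall_inP => w /set1P->.
  by rewrite adj_irrefl.
rewrite cardsU1 card_imset ?cardsT ?card_ord; last exact: set1_inj.
rewrite (_ : _ \notin _); first by rewrite add1n.
by apply/imsetP => -[x _ /esym/eqP]; rewrite -cards_eq0 cards1.
Qed.

Lemma num_independent_edgeless m : num_independent (edgeless m) = 2 ^ m.
Proof.
rewrite -[m in RHS]card_ord -cardsT -card_powerset; apply: eq_card => A.
rewrite !inE subsetT; apply/forall_inP => x _; apply/forall_inP => y _.
by [].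
Qed.

Section Sums.

Variables G H : sgraph.

Lemma in_imset_inl (A : {set G}) (x : G) :
  ((inl x : G + H) \in [set inl x | x in A]) = (x \in A).
Proof. by rewrite mem_imset //; apply: inl_inj. Qed.

Lemma in_imset_inr (B : {set H}) (y : H) :
  ((inr y : G + H) \in [set inr x | x in B]) = (y \in B).
Proof. by rewrite mem_imset //; apply: inr_inj. Qed.

Lemma inl_notin_imset_inr (B : {set H}) (x : G) :
  ((inl x : G + H) \in [set inr x | x in B]) = false.
Proof. by apply/negP => /imsetP[]. Qed.

Lemma inr_notin_imset_inl (A : {set G}) (y : H) :
  ((inr y : G + H) \in [set inl x | x in A]) = false.
Proof. by apply/negP => /imsetP[]. Qed.

Definition in_sum :=
  (in_imset_inl, in_imset_inr, inl_notin_imset_inr, inr_notin_imset_inl).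

Lemma num_independent_disjoint_union :
  num_independent (disjoint_union G H) = num_independent G * num_independent H.
Proof.
rewrite /num_independent -cardsX.
pose f (p : {set G} * {set H}) : {set disjoint_union G H} :=
  [set inl x | x in p.1] :|: [set inr y | y in p.2].
have finj : injective f.
  move=> [A B] [A' B'] /setP e; congr pair; apply/setP => x.
    by have := e (inl x); rewrite !inE !in_sum !orbF.
  by have := e (inr x); rewrite !inE !in_sum.
rewrite -(card_imset _ finj); apply: eq_card => C; rewrite inE.
apply/forall_inP/imsetP => [iC | [[A B]]]; last first.
  rewrite !inE => /= /andP[/forall_inP iA /forall_inP iB] ->.
  case=> x; rewrite !inE !in_sum ?orbF /= => xA; apply/forall_inP => -[] y;
    rewrite !inE !in_sum ?orbF //= => yA;
    [exact: (forall_inP (iA x xA)) | exact: (forall_inP (iB x xA))].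
exists ([set x | inl x \in C], [set y | inr y \in C]).
  rewrite !inE; apply/andP; split; apply/forall_inP => x; rewrite inE => xC;
    apply/forall_inP => y; rewrite inE => yC; exact: (forall_inP (iC _ xC) _ yC).
by apply/setP => -[] x; rewrite !inE !in_sum !inE ?orbF.
Qed.

(** An independent set lies on one side of a join, and only the empty set lies
    on both. *)
Lemma num_independent_join :
  num_independent (join G H) = num_independent G + num_independent H - 1.
Proof.
rewrite /num_independent.
pose U := [set [set (inl x : join G H) | x in A]
           | A : {set G} in [set A : {set G} | independent A]].
pose V := [set [set (inr x : join G H) | x in A]
           | A : {set H} in [set A : {set H} | independent A]].
have -> : [set C : {set join G H} | independent C] = U :|: V.
  apply/setP => C; rewrite !inE; apply/forall_inP/orP => [iC | []].
  - have [/existsP[x xC] | /existsPn nC] := boolP [exists x, inl x \in C].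
      left; apply/imsetP; exists [set x | inl x \in C].
        rewrite inE; apply/forall_inP => y; rewrite inE => yC;
        apply/forall_inP => z; rewrite inE => zC; exact: (forall_inP (iC _ yC) _ zC).
      apply/setP => -[] y; rewrite !in_sum ?inE //.
      by apply/negP => yC; have := forall_inP (iC _ xC) _ yC.
    right; apply/imsetP; exists [set x | inr x \in C].
      rewrite inE; apply/forall_inP => y; rewrite inE => yC;
      apply/forall_inP => z; rewrite inE => zC; exact: (forall_inP (iC _ yC) _ zC).
    by apply/setP => -[] y; rewrite !in_sum ?inE //; apply: negPf.
  - case/imsetP => A; rewrite inE => /forall_inP iA -> [] x; rewrite in_sum // => xA.
    apply/forall_inP => -[] y; rewrite in_sum // => yA; exact: (forall_inP (iA x xA)).
  - case/imsetP => A; rewrite inE => /forall_inP iA -> [] x; rewrite in_sum // => xA.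
    apply/forall_inP => -[] y; rewrite in_sum // => yA; exact: (forall_inP (iA x xA)).
rewrite cardsU !card_imset; try exact: imset_inj inl_inj; try exact: imset_inj inr_inj.
congr (_ - _); rewrite -(cards1 (set0 : {set join G H})); apply: eq_card => C; rewrite !inE.
apply/andP/eqP => [[/imsetP[A _ ->] /imsetP[B _ /setP e]] | ->].
  by apply/setP => -[] x; [rewrite e !in_sum inE | rewrite in_sum inE].
by split; apply/imsetP; exists set0; rewrite ?imset0 // inE; apply/forall_inP => x; rewrite inE.
Qed.

End Sums.

Lemma num_independent_Gstar k l n : 0 < k ->
  num_independent (Gstar k l n) =
    if k <= l then 2 ^ (n - l) + k * 2 ^ (l - k + 1) - 1
    else (k - l + 1) * 2 ^ (n - k) + l.
Proof.
move=> k0; rewrite /Gstar; case: leqP => _.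
  rewrite num_independent_join num_independent_disjoint_union.
  rewrite num_independent_complete !num_independent_edgeless addnC.
  by rewrite (_ : (k - 1).+1 = k) //; lia.
rewrite num_independent_join num_independent_disjoint_union.
by rewrite !num_independent_complete num_independent_edgeless addn1 addSn subn1 addnC.
Qed.

(** * Recognising the extremal graph *)

Lemma card_set_sum (A B : finType) (P : pred (A + B)) :
  #|[set u | P u]| = #|[set x | P (inl x)]| + #|[set y | P (inr y)]|.
Proof. by rewrite -!sum1dep_card big_sumType. Qed.

Lemma card_set_const (A : finType) (b : bool) : #|[set x : A | b]| = b * #|A|.
Proof.
case: b; first by rewrite mul1n -cardsT; apply: eq_card => x; rewrite !inE.
by rewrite mul0n -(cards0 A); apply: eq_card => x; rewrite !inE.
Qed.

(** The typing by which a graph is compared with the extremal graph, whose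
    vertices fall into three classes. *)
Definition part (T : finType) (A B : {set T}) (x : T) : nat :=
  if x \in A then 0 else if x \in B then 1 else 2.

Lemma card_part (T : finType) (A B : {set T}) i : [disjoint A & B] ->
  #|[set x | part A B x == i]| = nth 0 [:: #|A|; #|B|; #|T| - #|A| - #|B|] i.
Proof.
move=> dAB; have dis x : x \in A -> x \in B -> false.
  by move=> xA xB; rewrite (disjointFr dAB xA) in xB.
case: i => [|[|[|i]]] /=.
- by apply: eq_card => x; rewrite inE /part; case: (x \in A); case: (x \in B).
- apply: eq_card => x; rewrite inE /part; have := dis x.
  by case: (x \in A); case: (x \in B) => // /(_ isT isT).
- rewrite -subnDA -(cardsUI A B) (_ : A :&: B = set0); last first.
    by apply/setP => x; rewrite !inE; apply/negP => /andP[/dis h /h].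
  rewrite cards0 addn0 -cardsT -cardsDS ?subsetT //.
  by apply: eq_card => x; rewrite !inE /part; case: (x \in A); case: (x \in B).
- rewrite nth_nil; apply: eq_card0 => x; rewrite inE /part.
  by case: (x \in A); case: (x \in B).
Qed.

Lemma Gstar_leqP k l n (G : sgraph) (K L : {set G}) :
    0 < k -> k <= l -> #|G| = n -> #|L| = l -> K \subset L -> #|K| = k - 1 ->
    {in K &, forall x y, x != y -> adj x y} ->
    {in L :\: K & L, forall x y, ~~ adj x y} ->
    {in L & ~: L, forall x y, adj x y} -> independent (~: L) ->
  isomorphic G (Gstar k l n).
Proof.
move=> k0 kl nG cL sKL cK clK indL joinL /independentP iL.
rewrite /Gstar kl.
pose tH (u : join (disjoint_union (complete (k - 1)) (edgeless (l - k + 1)))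
                  (edgeless (n - l))) : nat :=
  match u with inl (inl _) => 0 | inl (inr _) => 1 | inr _ => 2 end.
(* The types are 0 for the clique, 1 for the rest of [L], 2 outside [L]. *)
pose r (i j : nat) := [|| (i == 0) && (j == 0), (i == 2) && (j < 2) | (j == 2) && (i < 2)].
apply: (@typed_isomorphic _ _ _ r (part K (L :\: K)) tH).
- move=> x y; rewrite /part /r !inE.
  have Lout z w : z \in L -> w \notin L -> adj z w.
    by move=> zL wL; apply: joinL; rewrite ?inE.
  have Lin z w : z \notin L -> w \notin L -> adj z w = false.
    by move=> zL wL; apply/negbTE; apply: iL; rewrite inE.
  have KL z : z \notin L -> z \in K = false.
    by move=> zL; apply: contraNF zL; apply: (subsetP sKL).
  have LK z w : z \in L -> z \notin K -> w \in L -> adj z w = false.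
    by move=> zL zK wL; apply/negbTE; apply: indL; rewrite // inE zK.
  have ne (z w : G) : adj z w -> z != w by apply: contraTneq => ->; rewrite adj_irrefl.
  have [xL|xL] := boolP (x \in L); have [yL|yL] := boolP (y \in L).
  + have [xK|xK] := boolP (x \in K); have [yK|yK] := boolP (y \in K);
      rewrite /= ?andbT ?andbF //.
    * by apply/idP/idP => [/ne//|]; apply: clK.
    * by rewrite adj_sym LK.
    * by rewrite LK.
    * by rewrite LK.
  + rewrite Lout // (ne _ _ (Lout _ _ xL yL)) (KL _ yL).
    by rewrite andbF; case: (x \in K).
  + rewrite adj_sym Lout // eq_sym (ne _ _ (Lout _ _ yL xL)) (KL _ xL).
    by rewrite andbF; case: (y \in K).
  + by rewrite Lin // !KL // !andbF.
- by move=> [[x|x]|x] [[y|y]|y]; rewrite /r /= ?andbT ?andbF.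
- move=> i; rewrite card_part; last first.
    by rewrite disjoints_subset; apply/subsetP => x; rewrite !inE => ->.
  rewrite !card_set_sum /= !card_set_const !card_ord cardsDS // cL cK nG.
  case: i => [|[|[|i]]] /=; rewrite ?nth_nil; lia.
Qed.

Lemma Gstar_gtnP k l n (G : sgraph) (K L : {set G}) :
    l < k -> #|G| = n -> #|L| = l -> [disjoint L & K] -> #|K| = k - l ->
    {in L :|: K &, forall x y, x != y -> adj x y} ->
    {in ~: (L :|: K) & ~: L, forall x y, ~~ adj x y} ->
    {in L & ~: (L :|: K), forall x y, adj x y} ->
  isomorphic G (Gstar k l n).
Proof.
move=> lk nG cL dLK cK clLK indK joinL.
rewrite /Gstar leqNgt lk /=.
pose tH (u : join (complete l)
                  (disjoint_union (complete (k - l)) (edgeless (n - k)))) : nat :=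
  match u with inl _ => 0 | inr (inl _) => 1 | inr (inr _) => 2 end.
(* The types are 0 for [L], 1 for the clique, 2 for the other vertices; only
   the pairs 1-2 and 2-2 are nonadjacent. *)
pose r i j := i + j < 3.
apply: (@typed_isomorphic _ _ _ r (part L K) tH).
- move=> x y; rewrite /part /r.
  have ne (z w : G) : adj z w -> z != w by apply: contraTneq => ->; rewrite adj_irrefl.
  have Kout z w : z \notin L -> z \notin K -> w \notin L -> adj z w = false.
    by move=> zL zK wL; apply/negbTE; apply: indK; rewrite !inE ?negb_or ?zL.
  have cl z w : (z \in L) || (z \in K) -> (w \in L) || (w \in K) -> adj z w = (z != w).
    by move=> hz hw; apply/idP/idP => [/ne//|]; apply: clLK; rewrite inE.
  have Lout z w : z \in L -> w \notin L -> w \notin K -> adj z w && (z != w).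
    move=> zL wL wK; have h : adj z w by apply: joinL; rewrite // !inE negb_or wL.
    by rewrite h ne.
  have [xL|xL] := boolP (x \in L); have [yL|yL] := boolP (y \in L).
  + by rewrite cl ?xL ?yL // andbT.
  + have [yK|yK] := boolP (y \in K); first by rewrite cl ?xL ?yK ?orbT // andbT.
    by have /andP[-> ->] := Lout _ _ xL yL yK.
  + have [xK|xK] := boolP (x \in K); first by rewrite cl ?yL ?xK ?orbT // andbT.
    by have := Lout _ _ yL xL xK; rewrite adj_sym eq_sym => /andP[-> ->].
  + have [xK|xK] := boolP (x \in K); have [yK|yK] := boolP (y \in K); rewrite /= ?andbT ?andbF.
    * by rewrite cl ?xK ?yK ?orbT.
    * by rewrite adj_sym Kout.
    * by rewrite Kout.
    * by rewrite Kout.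
- by move=> [x|[x|x]] [y|[y|y]]; rewrite /r /= ?andbT ?andbF.
- move=> i; rewrite card_part // !card_set_sum /= !card_set_const !card_ord cL cK nG.
  case: i => [|[|[|i]]] /=; rewrite ?nth_nil; lia.
Qed.

Lemma leq_bin m l : 0 < l < m -> m <= 'C(m, l).
Proof.
elim: m l => [|m IH] [|[|l]] //= h; first by rewrite bin1.
rewrite binS; have := IH l.+1; have : 0 < 'C(m, l.+2) by rewrite bin_gt0.
by move=> h1 h2; have := h2 h; lia.
Qed.

Lemma degree_geq (G : sgraph) l (v : G) : l <= min_degree G -> l <= degree v.
Proof.
move=> /leq_trans; apply; rewrite /min_degree.
have: v \in index_enum G by rewrite mem_index_enum.
elim: (index_enum G) => //= x s IH; rewrite inE big_cons geq_min.
by case/predU1P => [<-|/IH ->]; rewrite ?leqnn ?orbT.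
Qed.

(** * Every graph is below the extremal graph or isomorphic to it *)

Section Dichotomy.

Variables (k l : nat) (G : sgraph).
Hypotheses (k2 : 2 < k).
Hypotheses (chiG : chi_geq [set: G] k) (degG : forall v : G, l <= degree v).
Let n := #|G|.

(** The exponent [3 * (k + l)] makes the factor [(27/64) ^ (k + l)], which is
    less than [2 ^ - (k + l)]. *)
Lemma many_edges_bound :
  num_independent G * 4 ^ (3 * (k + l)) <= 3 ^ (3 * (k + l)) * 2 ^ n ->
  num_independent G < num_independent (Gstar k l n).
Proof.
rewrite !expnM -/(27 ^ _) -/(64 ^ _).
have q0 : 0 < k + l by lia.
have pow : 27 ^ (k + l) * 2 ^ (k + l) < 64 ^ (k + l).
  by rewrite -expnMn ltn_exp2r.
move=> h; have low : num_independent G * 2 ^ (k + l) < 2 ^ n.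
  have p1 : 0 < 64 ^ (k + l) by rewrite expn_gt0.
  have p2 : 0 < 2 ^ n by rewrite expn_gt0.
  rewrite -(ltn_pmul2r p1) mulnAC.
  apply: leq_ltn_trans (leq_mul h (leqnn (2 ^ (k + l)))) _.
  by rewrite mulnAC mulnC ltn_pmul2l.
rewrite -(ltn_pmul2r (_ : 0 < 2 ^ (k + l))) ?expn_gt0 //.
apply: leq_trans low _; rewrite num_independent_Gstar; last by lia.
have up j : j <= k + l -> 2 ^ n <= 2 ^ (n - j) * 2 ^ (k + l).
  by move=> jq; rewrite -expnD leq_exp2l //; lia.
case: (leqP k l) => kl.
  apply: leq_trans (up l (leq_addl _ _)) _; rewrite leq_mul2r; apply/orP; right.
  have : 0 < 2 ^ (l - k + 1) by rewrite expn_gt0.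
  by set a := 2 ^ _; set b := 2 ^ _ => ?; nia.
apply: leq_trans (up k (leq_addr _ _)) _; rewrite leq_mul2r; apply/orP; right.
by rewrite addn1; apply: leq_trans (leq_addr _ _); rewrite leq_pmull.
Qed.

Variable L : {set G}.
Hypotheses (cL : #|L| = l) (cC : 2 * (k + l) + 4 <= #|common_neighbours L|).

(** Used for [j = l] and [j = k]: the sets that meet [L] make up at most half of
    the quarter of [2 ^ (n - j)] by which [G - L] falls short of its bound. *)
Lemma exp_meeting_small j : j <= k + l -> 2 ^ #|~: common_neighbours L| * 8 <= 2 ^ (n - j).
Proof.
move=> jq; rewrite -[8]/(2 ^ 3) -expnD leq_exp2l //.
have := cardsC (common_neighbours L); rewrite -/n.
move: cC; set a := #|_|; set b := #|_|; lia.
Qed.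

Lemma card_compl_L : #|~: L| = n - l.
Proof. by rewrite /n -(cardsC L) cL addKn. Qed.

(** An edge outside [L] is too expensive. Without it the graph is the join of
    [L] and an independent set, and [L] needs [k - 1] colours. *)
Lemma dichotomy_leq : k <= l ->
  num_independent G < num_independent (Gstar k l n) \/ isomorphic G (Gstar k l n).
Proof.
move=> kl; rewrite num_independent_Gstar ?kl; last by lia.
have ek : 0 < k * 2 ^ (l - k + 1) by rewrite muln_gt0 expn_gt0; lia.
have [iL | nL] := boolP (independent (~: L)); last first.
  left; have := num_independent_split L; have := indep_count_not_independent nL.
  rewrite card_compl_L; have := exp_meeting_small (leq_addl k l).
  have : 0 < 2 ^ (n - l) by rewrite expn_gt0.
  by move: ek; lia.
have joinL : {in L & ~: L, forall x y, adj x y}.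
  move=> x y xL yL; rewrite adj_sym; apply: (@all_adjacent _ L) xL; first by rewrite cL.
  apply/subsetP => z; rewrite inE => yz; apply: contraTT yz => zL.
  by move/independentP: iL; apply; rewrite // inE.
have := num_independent_bipartition iL joinL; rewrite card_compl_L => hi.
have chiL : chi_geq L (k - 2).+1.
  have := chi_geq_setD (set_colorable_independent iL) chiG.
  rewrite setTD setCK (_ : k - 1 = (k - 2).+1) //; lia.
case: (indep_count_stability chiL) => [h | [K [sK cK clK indK]]]; [left | right].
  suff : indep_count L < k * 2 ^ (l - k + 1) by move: hi ek; lia.
  rewrite -(ltn_pmul2r (_ : 0 < 2 ^ (k - 2).+3)) ?expn_gt0 //.
  rewrite -mulnA -expnD (_ : l - k + 1 + (k - 2).+3 = l + 2); last by lia.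
  move: h; rewrite cL expnD (_ : (k - 2).+2 = k); last by lia.
  have : 0 < 2 ^ l by rewrite expn_gt0.
  set a := indep_count L; set b := 2 ^ _; set c := 2 ^ l; nia.
apply: (Gstar_leqP (K := K) (L := L)) => //; [lia | rewrite cK; lia].
Qed.

(** Outside the extremal case of [indep_count_stability] for [G - L] the gap
    settles the matter. In that case the vertices outside [L :|: K] are joined
    to [L] by the degree condition, and [L :|: K] must be a clique because
    otherwise [k - 1] colours suffice. *)
Lemma dichotomy_gtn : l < k ->
  num_independent G < num_independent (Gstar k l n) \/ isomorphic G (Gstar k l n).
Proof.
move=> lk; rewrite num_independent_Gstar 1?[k <= l]leqNgt ?lk /=; last by lia.
have chiL : chi_geq (~: L) (k - l - 1).+1.
  have := chi_geq_setD (set_colorable_card L) chiG.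
  by rewrite setTD cL (_ : (k - l - 1).+1 = k - l) //; lia.
case: (indep_count_stability chiL) => [h | [K [sK cK clK indK]]]; [left | right].
  have hs := num_independent_split L.
  have hm := exp_meeting_small (leq_addr l k).
  have e : 2 ^ (n - l) = 2 ^ (k - l) * 2 ^ (n - k).
    rewrite -expnD; congr (2 ^ _).
    have := cardsC (common_neighbours L); rewrite -/n.
    move: cC; set a := #|_|; set b := #|_|; lia.
  move: h; rewrite card_compl_L e (_ : (k - l - 1).+3 = (k - l) + 2); last by lia.
  rewrite (_ : (k - l - 1).+2 = k - l + 1); last by lia.
  rewrite expnD; have p : 0 < 2 ^ (k - l) by rewrite expn_gt0.
  rewrite (_ : _ + _ = 2 ^ (k - l) * (4 * indep_count (~: L) + 2 ^ (n - k))); last by lia.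
  rewrite mulnCA leq_pmul2l // => h.
  have : 0 < 2 ^ (n - k) by rewrite expn_gt0.
  move: h hs hm; rewrite -mulnA; set a := (_ + 1) * _; set b := 2 ^ (n - k); lia.
have dLK : [disjoint L & K] by rewrite disjoint_sym disjoints_subset.
have cK' : #|K| = k - l by rewrite cK; lia.
have adjL v : v \notin L -> {in ~: L, forall w, ~~ adj v w} -> {in L, forall x, adj v x}.
  move=> vL hv; apply: all_adjacent; first by rewrite cL.
  apply/subsetP => z; rewrite inE => vz; apply: contraTT vz => zL.
  by apply: hv; rewrite inE.
have outP v : v \notin L -> v \notin K -> {in ~: L, forall w, ~~ adj v w}.
  by move=> vL vK w wL; apply: indK; rewrite // !inE vK.
have joinL : {in L & ~: (L :|: K), forall x y, adj x y}.
  move=> x y xL; rewrite !inE negb_or => /andP[yL yK].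
  by rewrite adj_sym; apply: adjL xL => //; apply: outP.
apply: (Gstar_gtnP (K := K) (L := L)) => //; last first.
  by move=> x y; rewrite !inE negb_or => /andP[xL xK] yL; apply: outP; rewrite ?inE.
move=> a b aS bS ab; apply/negPn/negP => nab.
(* Two nonadjacent vertices [a] and [b] of [L :|: K] can share a colour. A
   clique vertex [u] other than these two can share its colour with all
   vertices outside [L :|: K], to none of which it is adjacent. *)
have [u [uK ua ub]] : exists u, [/\ u \in K, u != a & u != b].
  have abK : ~~ ((a \in K) && (b \in K)).
    by apply: contra nab => /andP[aK bK]; apply: clK.
  have [k1 | k1] := eqVneq (k - l) 1; last first.
    have : 0 < #|K :\: [set a; b]|.
      have sub : K :&: [set a; b] \subset [set if a \in K then a else b].
        apply/subsetP => z; rewrite !inE => /andP[zK /orP[] /eqP e].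
          by rewrite e in zK *; rewrite zK.
        by rewrite e in zK *; move: abK; rewrite zK andbT => /negPf->.
      have := cardsID [set a; b] K; have := subset_leq_card sub.
      rewrite cards1 cK'; lia.
    by case/card_gt0P => u; rewrite !inE negb_or => /andP[/andP[ua ub] uK]; exists u.
  (* A single clique vertex is isolated outside [L], so the degree condition
     joins it to [L] and it is neither [a] nor [b]. *)
  have /eqP/cards1P[u eK] : #|K| = 1 by rewrite cK'.
  have uK : u \in K by rewrite eK set11.
  have adju : {in L, forall x, adj u x}.
    apply: adjL; first by rewrite (disjointFl dLK uK).
    move=> w wL; have [->|wu] := eqVneq w u; first by rewrite adj_irrefl.
    by rewrite adj_sym; apply: indK; rewrite ?(subsetP sK) // inE wL eK inE wu.
  have inSu z : z \in L :|: K -> z != u -> z \in L.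
    by rewrite !inE eK inE => /orP[//|->].
  exists u; split=> //; apply/eqP => e; case/negP: nab.
    by rewrite -e; apply: adju; apply: inSu; rewrite // eq_sym e.
  by rewrite -e adj_sym; apply: adju; apply: inSu; rewrite // e.
pose S := L :|: K.
have cS : #|S| = k.
  by rewrite cardsU (disjoint_setI0 dLK) cards0 cL cK'; lia.
have colS : set_colorable (S :\ u) (k - 2).
  have uS : u \in S by rewrite inE uK orbT.
  have -> : k - 2 = #|S :\ u|.-1 by have := cardsD1 u S; rewrite uS cS; lia.
  apply: (@set_colorable_nonadjacent _ _ a b) => //.
    by rewrite in_setD1 aS andbT eq_sym.
  by rewrite in_setD1 bS andbT eq_sym.
have colR : set_colorable (u |: ~: S) 1.
  apply: set_colorable_independent; apply/independentP => x y.
  rewrite !inE !negb_or.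
  have uL : u \notin L by rewrite (disjointFl dLK uK).
  case/orP => [/eqP->|/andP[xL xK]].
    case/orP => [/eqP->|/andP[yL yK]]; first by rewrite adj_irrefl.
    by rewrite adj_sym outP // inE.
  by case/orP => [/eqP->|/andP[yL yK]]; apply: outP => //; rewrite inE.
have := chiG (set_colorable_sub _ (set_colorable_setU colS colR)).
have -> : [set: G] \subset S :\ u :|: (u |: ~: S).
  by apply/subsetP => x _; rewrite !inE; case: (x == u); case: (x \in L); case: (x \in K).
by move=> /(_ isT); lia.
Qed.

End Dichotomy.

Theorem theorem1p3 (k l n : nat) (hk : 2 < k) (hl : 1 <= l)
    (hn : 2 * (k + l + 2) * 'C(6 * (k + l), l) < n)
    (G : sgraph) (hG : #|G| = n) (hchi : chromatic_number G = k)
    (hdeg : l <= min_degree G) :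
  [/\ num_independent G <= num_independent (Gstar k l n),
      num_independent (Gstar k l n) =
        (if k <= l then 2 ^ (n - l) + k * 2 ^ (l - k + 1) - 1
         else (k - l + 1) * 2 ^ (n - k) + l)
    & num_independent G = num_independent (Gstar k l n) <->
        isomorphic G (Gstar k l n)].
Proof.
have dich : num_independent G < num_independent (Gstar k l n) \/
    isomorphic G (Gstar k l n).
  subst n; have degG v := degree_geq v hdeg.
  have chiG : chi_geq [set: G] k by rewrite -hchi; apply: chi_geq_setT.
  case: (matching_or_cover (3 * (k + l)) [set: G]) => [h | [T [cT iT]]].
    by left; apply: many_edges_bound => //; move: h; rewrite -num_independentE cardsT.
  rewrite setTD in iT.
  have [|L [cL cC]] := @exists_common_neighbours _ T l (2 * (k + l) + 3) iT degG.
    have b1 : 'C(#|T|, l) <= 'C(6 * (k + l), l) by apply: leq_bin2l; lia.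
    have b2 : 6 * (k + l) <= 'C(6 * (k + l), l) by apply: leq_bin; lia.
    apply: leq_ltn_trans (leq_mul (leqnn _) b1) _.
    have := cardsC T; move: hn cT b2.
    set b := 'C(_, _); set c := #|T|; set d := #|_|; lia.
  have cC' : 2 * (k + l) + 4 <= #|common_neighbours L| by lia.
  case: (leqP k l) => kl; first exact: (dichotomy_leq hk chiG degG cL cC').
  exact: (dichotomy_gtn hk chiG degG cL cC').
have formula := @num_independent_Gstar k l n (ltnW (ltnW hk)).
split=> //; case: dich => [lt|iso].
- exact: ltnW.
- by rewrite (num_independent_isomorphic iso).
- by split=> [e|/num_independent_isomorphic //]; rewrite e ltnn in lt.
- by split=> // _; apply: num_independent_isomorphic.
Qed.
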